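(* Let $n\ge 1$, $k\ge 1$ be integers, let $\lambda^{(1)},\dots,\lambda^{(2k)}\in\mathbb Z^n$ be decreasing vectors, and fix $i_1\in\{1,\dots,n\}$. Then $$\mathfrak D_{\lambda^{(1)},\dots,\lambda^{(2k)}}=\sum_{I}(-1)^{i_1+\dots+i_{2k}}\,\mathfrak D_{\mu^{(1)}_I,\dots,\mu^{(2k)}_I},$$ where the sum is over the $2k$-tuples $I=[i_1,i_2,\dots,i_{2k}]\in\{1,\dots,n\}^{2k}$ whose first entry is the fixed $i_1$ and which satisfy $$\lambda^{(1)}_{n-i_1+1}+\dots+\lambda^{(2k)}_{n-i_{2k}+1}+i_1+\dots+i_{2k}=(2k-1)n+1,$$ and the decreasing vectors $\mu^{(1)}_I,\dots,\mu^{(2k)}_I\in\mathbb Z^{n-1}$ are defined by $$\mu_I^{(1)}=[\lambda_1^{(1)}-2(k-1),\dots,\lambda_{n-i_1}^{(1)}-2(k-1),\ \lambda_{n-i_1+2}^{(1)}-2(k-1)-1,\dots,\lambda_n^{(1)}-2(k-1)-1]$$ and, for $2\le j\le 2k$, $$\mu_I^{(j)}=[\lambda_1^{(j)}+1,\dots,\lambda_{n-i_j}^{(j)}+1,\ \lambda_{n-i_j+2}^{(j)},\dots,\lambda_n^{(j)}].$$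
   Context: For a tensor $\mathrm M=(M_{i_1,\dots,i_{2k}})_{1\le i_1,\dots,i_{2k}\le n}$, the hyperdeterminant is $$\mathrm{Det}(\mathrm M)=\frac1{n!}\sum_{\sigma_1,\dots,\sigma_{2k}\in\mathfrak S_n}\mathrm{sign}(\sigma_1\cdots\sigma_{2k})\prod_{i=1}^n M_{\sigma_1(i),\dots,\sigma_{2k}(i)},$$ where $\mathfrak S_n$ is the symmetric group (so it equals $1$ when $n=0$). A vector $\lambda=[\lambda_1,\dots,\lambda_n]\in\mathbb Z^n$ is called decreasing if $\lambda_1\ge\dots\ge\lambda_n$. For $2k$ decreasing vectors $\lambda^{(1)},\dots,\lambda^{(2k)}\in\mathbb Z^n$, define $$\Delta_{\lambda^{(1)},\dots,\lambda^{(2k)}}=\left(\delta_{\lambda^{(1)}_{n-i_1+1}+\dots+\lambda^{(2k)}_{n-i_{2k}+1}+i_1+\dots+i_{2k},\,(2k-1)n+1}\right)_{1\le i_1,\dots,i_{2k}\le n}$$ ($\delta$ is the Kronecker delta) and $\mathfrak D_{\lambda^{(1)},\dots,\lambda^{(2k)}}=\mathrm{Det}(\Delta_{\lambda^{(1)},\dots,\lambda^{(2k)}})$. The same definition with $n$ replaced by $n-1$ is used for vectors in $\mathbb Z^{n-1}$. *)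

(* Defs.v *)
From HB Require Import structures.
From mathcomp Require Import all_boot all_order all_fingroup all_algebra.

Set Implicit Arguments.
Unset Strict Implicit.
Unset Printing Implicit Defensive.

Import Order.TTheory GRing.Theory Num.Theory.
Local Open Scope ring_scope.

(* Indices are 0-based: an ordinal i stands for the 1-based index i + 1.  In
   particular the 1-based position n - i + 1 is [rev_ord i]. *)

(* Order 2k tensors with all indices in 'I_n. *)
Definition tensor (F : Type) (k n : nat) := {ffun 'I_(2 * k) -> 'I_n} -> F.

Definition hyperdet (F : numFieldType) (k n : nat) (M : tensor F k n) : F :=
  (n`!%:R)^-1 *
  \sum_(s : {ffun 'I_(2 * k) -> 'S_n})
     (-1) ^+ odd_perm (\prod_(j < 2 * k) s j)%g *
     \prod_(i < n) M [ffun j => s j i].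

Definition decreasing (n : nat) (v : 'rV[int]_n) : Prop :=
  forall p q : 'I_n, (p <= q)%N -> v 0 q <= v 0 p.

(* lambda^(1)_{n-i_1+1} + ... + lambda^(2k)_{n-i_2k+1} + i_1 + ... + i_2k
   = (2k-1) n + 1 *)
Definition balanced (k n : nat) (lam : 'I_(2 * k) -> 'rV[int]_n)
    (I : {ffun 'I_(2 * k) -> 'I_n}) : bool :=
  \sum_(j < 2 * k) lam j 0 (rev_ord (I j)) + \sum_(j < 2 * k) ((I j).+1)%:Z
  == ((2 * k)%:Z - 1) * n%:Z + 1.

Definition Delta (k n : nat) (lam : 'I_(2 * k) -> 'rV[int]_n) : tensor rat k n :=
  fun I => (balanced lam I)%:R.

Definition frakD (k n : nat) (lam : 'I_(2 * k) -> 'rV[int]_n) : rat :=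
  hyperdet (Delta lam).

(* The slot carrying lambda^(1). *)
Definition slot1 (k : nat) (hk : (0 < k)%N) : 'I_(2 * k) :=
  Ordinal (etrans (muln_gt0 2 k) hk).

(* The vector mu_I^(j) is lambda^(j) with its 1-based entry n - i_j + 1 deleted
   ([lift (rev_ord (I j))] skips that position), then shifted: the entries
   before the deleted one are those with [p < rev_ord (I j)]. *)
Definition mu (k n : nat) (lam : 'I_(2 * k) -> 'rV[int]_n)
    (I : {ffun 'I_(2 * k) -> 'I_n}) (j : 'I_(2 * k)) : 'rV[int]_n.-1 :=
  \row_(p < n.-1)
    let x := lam j 0 (lift (rev_ord (I j)) p) in
    if val j == 0%N then
      if (p < rev_ord (I j))%N then x - 2 * (k%:Z - 1)
      else x - 2 * (k%:Z - 1) - 1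
    else
      if (p < rev_ord (I j))%N then x + 1 else x.

(* Main.v *)
(* The vectors mu_I are chosen so that Delta(mu_I) is the minor of
   Delta(lambda) obtained by deleting the index i_j in each direction j; the
   identity is then the Laplace expansion of the hyperdeterminant along the
   slice with first index i_1, in which only the entries equal to 1, i.e. the
   balanced I, survive.  For the Laplace expansion, split the sum over tuples
   of permutations according to x = s_1^-1(i_1) and I = (s_j(x))_j.  Each s_j
   lifts a permutation of n-1 letters with sign change (-1)^(x + i_j), and the
   even number of directions makes the result independent of x. *)

Require Import Defs.
From HB Require Import structures.
From mathcomp Require Import all_boot all_order all_fingroup all_algebra.
From mathcomp Require Import zify.

Set Implicit Arguments.
Unset Strict Implicit.
Unset Printing Implicit Defensive.

Import Order.TTheory GRing.Theory Num.Theory.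
Local Open Scope ring_scope.

Lemma lift_perm_inj (n : nat) (i j : 'I_n.+1) : injective (lift_perm i j).
Proof.
move=> s t est; apply/permP=> p; apply: (@lift_inj _ j).
by rewrite -!(lift_perm_lift i j) est.
Qed.

(** Off [i], the injective map [s] avoids the value [s i], so its values can be unlifted there. *)
Lemma lift_perm_onto (n : nat) (i : 'I_n.+1) (s : 'S_n.+1) :
  {t : 'S_n | lift_perm i (s i) t = s}.
Proof.
have neq p : s i != s (lift i p) by rewrite (inj_eq perm_inj) neq_lift.
pose f p := s2val (unlift_some (neq p)).
have fE p : lift (s i) (f p) = s (lift i p) by rewrite -(s2valP (unlift_some _)).
have f_inj : injective f.
  move=> p q /(congr1 (lift (s i))); rewrite !fE.
  by move=> /perm_inj /lift_inj.
exists (perm f_inj); apply/permP=> p.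
case: (unliftP i p) => [q|] ->; last by rewrite lift_perm_id.
by rewrite lift_perm_lift permE fE.
Qed.

Definition minor (F : Type) (k n : nat) (M : tensor F k n.+1)
    (I : {ffun 'I_(2 * k) -> 'I_n.+1}) : tensor F k n :=
  fun J => M [ffun j => lift (I j) (J j)].

Lemma sign_odd_perm_prod (R : pzRingType) (T : finType) (I : Type) (r : seq I)
    (P : pred I) (s : I -> {perm T}) :
  (-1) ^+ odd_perm (\prod_(j <- r | P j) s j)%g
    = \prod_(j <- r | P j) (-1) ^+ odd_perm (s j) :> R.
Proof.
apply: (big_morph (fun s : {perm T} => (-1) ^+ odd_perm s)).
  by move=> s1 s2 /=; rewrite odd_permM signr_addb.
by rewrite odd_perm1.
Qed.

Lemma hyperdet_laplace (F : numFieldType) (k n : nat) (M : tensor F k n.+1)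
    (j0 : 'I_(2 * k)) (i0 : 'I_n.+1) :
  hyperdet M =
    \sum_(I : {ffun 'I_(2 * k) -> 'I_n.+1} | I j0 == i0)
       (-1) ^+ (\sum_(j < 2 * k) (I j).+1)%N * (M I * hyperdet (minor M I)).
Proof.
pose G (s : {ffun 'I_(2 * k) -> 'S_n.+1}) :=
  (-1) ^+ odd_perm (\prod_(j < 2 * k) s j)%g *
     \prod_(i < n.+1) M [ffun j => s j i].
(* The right-hand side does not depend on [x]: each of the [n.+1] possible positions of [i0]
   contributes equally. *)
have Gx x :
    \sum_(s : {ffun 'I_(2 * k) -> 'S_n.+1} | s j0 x == i0) G s = n`!%:R *
    \sum_(I : {ffun 'I_(2 * k) -> 'I_n.+1} | I j0 == i0)
       (-1) ^+ (\sum_(j < 2 * k) (I j).+1)%N * (M I * hyperdet (minor M I)).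
  rewrite (partition_big
    (fun s : {ffun 'I_(2 * k) -> 'S_n.+1} => [ffun j => s j x])
    (fun I : {ffun 'I_(2 * k) -> 'I_n.+1} => I j0 == i0)) /=; last first.
    by move=> s; rewrite ffunE.
  rewrite mulr_sumr; apply: eq_bigr => I /eqP I0.
  pose h (t : {ffun 'I_(2 * k) -> 'S_n}) := [ffun j => lift_perm x (I j) (t j)].
  pose h' (s : {ffun 'I_(2 * k) -> 'S_n.+1}) :=
    [ffun j => sval (lift_perm_onto x (s j))].
  (* Tuples in ['S_n] correspond through [h] to the tuples in ['S_n.+1] taking the values [I] at
     [x]. *)
  rewrite (reindex_onto h h') /=; last first.
    move=> s /andP[_ /eqP sI]; apply/ffunP=> j; rewrite !ffunE -sI ffunE.
    by case: lift_perm_onto.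
  rewrite (eq_bigl xpredT) => [|t]; last first.
    rewrite ffunE lift_perm_id I0 eqxx /=; apply/andP; split.
      by apply/eqP/ffunP=> j; rewrite !ffunE lift_perm_id.
    apply/eqP/ffunP=> j; rewrite !ffunE.
    case: lift_perm_onto => u /=; rewrite lift_perm_id.
    exact: lift_perm_inj.
  rewrite /hyperdet !mulrA [n`!%:R * _ * M I * _]mulrAC.
  rewrite [n`!%:R * _ * _]mulrAC mulfV ?pnatr_eq0 -?lt0n ?fact_gt0 // mul1r.
  rewrite mulr_sumr; apply: eq_bigr => t _.
  rewrite /G !sign_odd_perm_prod (bigD1_ord x) //=.
  have -> : \prod_(j < 2 * k) (-1) ^+ odd_perm (h t j) =
      (-1) ^+ (\sum_(j < 2 * k) (I j).+1)%N
        * \prod_(j < 2 * k) (-1) ^+ odd_perm (t j) :> F.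
    (* The lift has sign factor (-1)^(x + I j); raising both exponents by one keeps it and yields
       the 1-based indices. *)
    have hE j : (-1) ^+ odd_perm (h t j) =
        (-1) ^+ x.+1 * ((-1) ^+ (I j).+1 * (-1) ^+ odd_perm (t j)) :> F.
      rewrite ffunE odd_lift_perm !signr_addb !signr_odd !exprS !mulN1r.
      by rewrite !mulNr mulrN opprK !mulrA.
    (* The factor (-1)^(x+1) occurs [2 * k] times, hence cancels. *)
    rewrite (eq_bigr _ (fun j _ => hE j)) 2!big_split /= prodrXr big_const_ord.
    by rewrite iter_addn_0 mulnCA exprM sqrrN !expr1n mul1r prodrXr.
  have -> : [ffun j => h t j x] = I.
    by apply/ffunP=> j; rewrite !ffunE lift_perm_id.
  rewrite -!mulrA; congr (_ * _); rewrite mulrCA; congr (_ * (_ * _)).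
  apply: eq_bigr => i _; congr (M _).
  by apply/ffunP=> j; rewrite !ffunE lift_perm_lift.
rewrite {1}/hyperdet -/G.
rewrite (partition_big
    (fun s : {ffun 'I_(2 * k) -> 'S_n.+1} => (s j0)^-1%g i0) xpredT) //=.
under eq_bigr => x _.
  rewrite (eq_bigl (fun s : {ffun 'I_(2 * k) -> 'S_n.+1} => s j0 x == i0)); last first.
    by move=> s; rewrite (can2_eq (permKV _) (permK _)) eq_sym.
  rewrite Gx; over.
(* The [n.+1] equal sums, each carrying n!, absorb the normalisation 1/(n+1)!. *)
rewrite sumr_const card_ord -[_ *+ n.+1]mulr_natl [n.+1%:R * _]mulrA -natrM -factS.
by rewrite mulKf // pnatr_eq0 -lt0n fact_gt0.
Qed.

(** In every slot, entries before the deleted one are shifted by one more than those after it. *)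
Lemma decreasing_mu (k n : nat) (lam : 'I_(2 * k) -> 'rV[int]_n)
    (I : {ffun 'I_(2 * k) -> 'I_n}) (j : 'I_(2 * k)) :
  decreasing (lam j) -> decreasing (mu lam I j).
Proof.
move=> dec p q le_pq; rewrite !mxE.
have := dec (lift (rev_ord (I j)) p) (lift (rev_ord (I j)) q).
rewrite /= leq_bump2 => /(_ le_pq).
case: eqP => _; case: ltnP => hq; case: ltnP => hp; lia.
Qed.

(** The shifts in [mu] compensate for the index jumps of [lift], except for a deficit of 2k-1 in the
    first slot. This is exactly the drop of the right-hand side from (2k-1)(n+1)+1 to (2k-1)n+1. *)
Lemma balanced_mu (k n : nat) (hk : (0 < k)%N)
    (lam : 'I_(2 * k) -> 'rV[int]_n.+1)
    (I : {ffun 'I_(2 * k) -> 'I_n.+1}) (J : {ffun 'I_(2 * k) -> 'I_n}) :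
  @balanced k n (mu lam I) J = balanced lam [ffun j => lift (I j) (J j)].
Proof.
rewrite /balanced -!big_split /=.
have E j : mu lam I j 0 (rev_ord (J j)) + (J j).+1%:Z =
    (lam j 0 (rev_ord (lift (I j) (J j))) + (lift (I j) (J j)).+1%:Z)
      - (if j == slot1 hk then 2 * k%:Z - 1 else 0).
  have -> : rev_ord (lift (I j) (J j)) = lift (rev_ord (I j)) (rev_ord (J j)).
    apply: val_inj; rewrite /= /bump.
    by have := ltn_ord (I j); have := ltn_ord (J j); lia.
  rewrite mxE -val_eqE /=.
  have := ltn_ord (I j); have := ltn_ord (J j).
  move: (lam _ _ _) => y ltJ ltI; rewrite /bump.
  by case: eqP => _; case: ltnP; case: leqP; lia.
under eq_bigr => j _ do rewrite E.
rewrite big_split /= sumrN -big_mkcond big_pred1_eq.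
rewrite subr_eq; congr (_ == _); last by lia.
by apply: eq_bigr => j _; rewrite ffunE.
Qed.

Lemma hyperdet_ext (F : numFieldType) (k n : nat) (M N : tensor F k n) :
  M =1 N -> hyperdet M = hyperdet N.
Proof.
move=> eqMN; congr (_ * _); apply: eq_bigr => s _; congr (_ * _).
by apply: eq_bigr => i _.
Qed.

Theorem corollary4p8 (n k : nat) (hn : (1 <= n)%N) (hk : (1 <= k)%N)
    (lam : 'I_(2 * k) -> 'rV[int]_n)
    (hlam : forall j : 'I_(2 * k), decreasing (lam j))
    (i1 : 'I_n) :
  (forall I : {ffun 'I_(2 * k) -> 'I_n},
     I (slot1 hk) = i1 -> balanced lam I ->
     forall j : 'I_(2 * k), decreasing (mu lam I j)) /\
  frakD lam =
    \sum_(I : {ffun 'I_(2 * k) -> 'I_n} | (I (slot1 hk) == i1) && balanced lam I)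
       (-1) ^+ (\sum_(j < 2 * k) (I j).+1)%N * frakD (mu lam I).
Proof.
split=> [I _ _ j|]; first exact/decreasing_mu/hlam.
case: n hn lam hlam i1 => // n _ lam _ i1.
(* Balancedness becomes a conditional summand, to be matched with the 0-1 entry of [Delta lam] at
   [I]. *)
rewrite /frakD (hyperdet_laplace _ (slot1 hk) i1) big_mkcondr.
apply: eq_bigr => I _; rewrite {1}/Delta.
case: ifP => _; last by rewrite mul0r mulr0.
rewrite mul1r; congr (_ * _); apply: hyperdet_ext => J.
by rewrite /minor /Delta balanced_mu.
Qed.
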